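(* Let $\pi\in(0,\tfrac12)$, $\|\mu\|_2>0$, $\tau\in(0,\infty)$, and $\delta>0$ with $\delta<\delta^*(0)$. Let $(\rho^*,\beta_0^*,\kappa^* )$ be the asymptotic parameters of the SVM defined in the context, and set $$\mathcal L_*=\mathrm{Law}\bigl(\max\{\kappa^*,\ \rho^*\|\mu\|_2+G+Y\beta_0^*\}\bigr),\qquad\mathcal L_*^{\rm test}=\mathrm{Law}\bigl(\rho^*\|\mu\|_2+G+Y\beta_0^*\bigr).$$ Then $\mathtt T^*(x)=\max\{\kappa^*,x\}$ is the unique optimal transport map from $\mathcal L_*^{\rm test}$ to $\mathcal L_*$ under the cost function $c(x,y)=h(x-y)$ for any strictly convex $h:\mathbb R\to\mathbb R_{\ge0}$. That is, $$\mathtt T^*=\arg\min_{\mathtt T:\mathbb R\to\mathbb R}\left\{\int_{\mathbb R}c(x,\mathtt T(x))\,d\mathcal L_*^{\rm test}(x)\ :\ \mathtt T_\sharp\mathcal L_*^{\rm test}=\mathcal L_*\right\},$$ where $\mathtt T_\sharp$ is the push-forward operator.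
   Context: $(Y,G)$ are independent, $\mathbb P(Y=+1)=\pi=1-\mathbb P(Y=-1)$, $G\sim\mathsf N(0,1)$, $a_+=\max\{a,0\}$, $s(+1)=\tau$, $s(-1)=1$ (with $\tau=1$ corresponding to the ordinary SVM). With $$H_\kappa(\rho,\beta_0)=\frac{1-\rho^2}{\mathbb E[(s(Y)\kappa-\rho\|\mu\|_2+G-\beta_0Y)_+^2]},\qquad\delta^*(\kappa)=\max_{\rho\in[-1,1],\,\beta_0\in\mathbb R}H_\kappa(\rho,\beta_0),$$ for $\delta<\delta^*(0)$, $(\rho^*,\beta_0^*,\kappa^* )$ denotes the unique solution of: maximize $\kappa$ over $\rho\in[-1,1],\beta_0\in\mathbb R,\kappa\in\mathbb R$ subject to $H_\kappa(\rho,\beta_0)\ge\delta$.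
   Formalization: Uniqueness of T* is stated almost everywhere under L_*^test and only when the cost of T* is finite; otherwise it fails (e.g. h(u)=exp(u^4) makes every transport map's cost infinite, so all are minimizers). Optimality of T* is unconditional. *)

(* Defs.v *)
From HB Require Import structures.
From mathcomp Require Import all_boot all_order all_algebra.
From mathcomp Require Import all_classical all_reals all_analysis.
From mathcomp Require Import measurable_realfun.

Set Implicit Arguments.
Unset Strict Implicit.
Unset Printing Implicit Defensive.

Import Order.TTheory GRing.Theory Num.Theory.
Import numFieldNormedType.Exports.

Local Open Scope classical_set_scope.
Local Open Scope ring_scope.

Definition l2norm (R : realType) (p : nat) (mu : 'rV[R]_p) : R :=
  Num.sqrt (\sum_(i < p) mu ord0 i ^+ 2).

Definition independent_rv (d : measure_display) (Omega : measurableType d)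
    (R : realType) (P : probability Omega R) (X1 X2 : {RV P >-> R}) : Prop :=
  forall A B : set R, measurable A -> measurable B ->
    P (X1 @^-1` A `&` X2 @^-1` B) = (P (X1 @^-1` A) * P (X2 @^-1` B))%E.

Definition label_noise_pair (d : measure_display) (Omega : measurableType d)
    (R : realType) (P : probability Omega R) (prior : R)
    (Y G : {RV P >-> R}) : Prop :=
  [/\ P [set w | Y w = 1] = prior%:E,
      P [set w | Y w = -1] = (1 - prior)%:E,
      forall A : set R, measurable A -> distribution P G A = normal_prob 0 1 A
    & independent_rv Y G].

(* Only evaluated at labels y = +1 and y = -1 (almost surely). *)
Definition margin_scale (R : realType) (tau y : R) : R :=
  if y == 1 then tau else 1.

(* The expectation is finite and positive (G is Gaussian and Y bounded), so
   that neither [fine] nor the division takes a default value. *)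
Definition svm_H (d : measure_display) (Omega : measurableType d)
    (R : realType) (P : probability Omega R) (Y G : {RV P >-> R})
    (p : nat) (mu : 'rV[R]_p) (tau kappa rho beta0 : R) : R :=
  (1 - rho ^+ 2) /
  fine 'E_P[fun w => Num.max (margin_scale tau (Y w) * kappa
                              - rho * l2norm mu + G w - beta0 * Y w) 0 ^+ 2].

(* dmax = delta^*(kappa), the (attained) maximum of H_kappa over
   rho in [-1, 1] and beta0 in R. *)
Definition is_delta_star (d : measure_display) (Omega : measurableType d)
    (R : realType) (P : probability Omega R) (Y G : {RV P >-> R})
    (p : nat) (mu : 'rV[R]_p) (tau kappa dmax : R) : Prop :=
  let values :=
    [set svm_H Y G mu tau kappa z.1 z.2 | z in `[-1, 1] `*` [set: R]] in
  values dmax /\ ubound values dmax.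

Definition svm_feasible (d : measure_display) (Omega : measurableType d)
    (R : realType) (P : probability Omega R) (Y G : {RV P >-> R})
    (p : nat) (mu : 'rV[R]_p) (tau delta rho beta0 kappa : R) : Prop :=
  -1 <= rho <= 1 /\ delta <= svm_H Y G mu tau kappa rho beta0.

Definition svm_solution (d : measure_display) (Omega : measurableType d)
    (R : realType) (P : probability Omega R) (Y G : {RV P >-> R})
    (p : nat) (mu : 'rV[R]_p) (tau delta rho beta0 kappa : R) : Prop :=
  svm_feasible Y G mu tau delta rho beta0 kappa /\
  forall rho' beta0' kappa' : R,
    svm_feasible Y G mu tau delta rho' beta0' kappa' -> kappa' <= kappa.

Definition test_margin (d : measure_display) (Omega : measurableType d)
    (R : realType) (P : probability Omega R) (Y G : {RV P >-> R})
    (p : nat) (mu : 'rV[R]_p) (rho beta0 : R) : Omega -> R :=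
  fun w => rho * l2norm mu + G w + Y w * beta0.

Lemma measurable_test_margin (d : measure_display) (Omega : measurableType d)
    (R : realType) (P : probability Omega R) (Y G : {RV P >-> R})
    (p : nat) (mu : 'rV[R]_p) (rho beta0 : R) :
  measurable_fun [set: Omega] (test_margin Y G mu rho beta0).
Proof.
by apply: measurable_funD; [exact: measurable_funD|exact: measurable_funM].
Qed.

HB.instance Definition _ (d : measure_display) (Omega : measurableType d)
    (R : realType) (P : probability Omega R) (Y G : {RV P >-> R})
    (p : nat) (mu : 'rV[R]_p) (rho beta0 : R) :=
  isMeasurableFun.Build _ _ _ _ (test_margin Y G mu rho beta0)
    (measurable_test_margin Y G mu rho beta0).

Definition train_margin (d : measure_display) (Omega : measurableType d)
    (R : realType) (P : probability Omega R) (Y G : {RV P >-> R})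
    (p : nat) (mu : 'rV[R]_p) (rho beta0 kappa : R) : Omega -> R :=
  fun w => Num.max kappa (rho * l2norm mu + G w + Y w * beta0).

Lemma measurable_train_margin (d : measure_display) (Omega : measurableType d)
    (R : realType) (P : probability Omega R) (Y G : {RV P >-> R})
    (p : nat) (mu : 'rV[R]_p) (rho beta0 kappa : R) :
  measurable_fun [set: Omega] (train_margin Y G mu rho beta0 kappa).
Proof. by apply: measurable_maxr => //; exact: measurable_test_margin. Qed.

HB.instance Definition _ (d : measure_display) (Omega : measurableType d)
    (R : realType) (P : probability Omega R) (Y G : {RV P >-> R})
    (p : nat) (mu : 'rV[R]_p) (rho beta0 kappa : R) :=
  isMeasurableFun.Build _ _ _ _ (train_margin Y G mu rho beta0 kappa)
    (measurable_train_margin Y G mu rho beta0 kappa).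

Definition strictly_convex (R : realType) (h : R -> R) : Prop :=
  forall x y t : R, x != y -> 0 < t < 1 ->
    h (t * x + (1 - t) * y) < t * h x + (1 - t) * h y.

Definition transport_map (R : realType)
    (m1 m2 : probability R R) (T : R -> R) : Prop :=
  measurable_fun [set: R] T /\
  forall A : set R, measurable A -> pushforward m1 T A = m2 A.

Definition transport_cost (R : realType) (m1 : probability R R)
    (c : R -> R -> R) (T : R -> R) : \bar R :=
  (\int[m1]_x (c x (T x))%:E)%E.

(* If the minimal cost is +oo, every transport map satisfies this predicate;
   uniqueness of the minimizer is therefore meaningful only at finite cost. *)
Definition optimal_transport_map (R : realType)
    (m1 m2 : probability R R) (c : R -> R -> R) (T : R -> R) : Prop :=
  transport_map m1 m2 T /\
  forall T' : R -> R, transport_map m1 m2 T' ->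
    (transport_cost m1 c T <= transport_cost m1 c T')%E.

(* Main.v *)
(* Optimality is Kantorovich duality with explicit potentials. Let [s] be a
   subgradient of [h] at 0. For [y >= kappa], strict convexity gives
     h (x - max(kappa, x)) + s * max(kappa, x) <= h (x - y) + s * y,
   with equality only at [y = max(kappa, x)]. Take [y = T x] and integrate: [T x]
   and [max(kappa, x)] have the same law under the source measure, so the terms
   in [s] cancel as soon as the target has a finite first moment, which leaves
   the comparison of the costs. Equality of finite costs forces equality
   almost everywhere. *)

Require Import Defs.
From HB Require Import structures.
From mathcomp Require Import all_boot all_order all_algebra.
From mathcomp Require Import all_classical all_reals all_analysis.
From mathcomp Require Import measurable_realfun.
From mathcomp Require Import ring lra.

Set Implicit Arguments.
Unset Strict Implicit.
Unset Printing Implicit Defensive.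

Import Order.TTheory GRing.Theory Num.Theory.
Import numFieldNormedType.Exports.

Local Open Scope classical_set_scope.
Local Open Scope ring_scope.

(** * Strictly convex functions on the line: measurability, subgradients, chord slopes *)

Lemma strictly_convex_convex (R : realType) (h : R -> R) (x y t : R) :
  strictly_convex h -> 0 <= t <= 1 ->
  h (t * x + (1 - t) * y) <= t * h x + (1 - t) * h y.
Proof.
move=> hc /andP[]; rewrite le_eqVlt => /predU1P[<- _|t0].
  by rewrite !mul0r !add0r subr0 !mul1r.
rewrite le_eqVlt => /predU1P[->|t1].
  by rewrite subrr !mul0r !addr0 !mul1r.
have [->|xy] := eqVneq x y; first by rewrite -!mulrDl addrC subrK !mul1r.
by apply/ltW/hc => //; rewrite t0 t1.
Qed.

(** The open rays []-oo, r[] generate the Borel sets, and convexity makes their preimages under [h]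
    intervals. *)
Lemma strictly_convex_measurable (R : realType) (h : R -> R) :
  strictly_convex h -> measurable_fun [set: R] h.
Proof.
move=> hc; apply: (measurability _ (RGenInftyO.measurableE R)).
move=> _ [_ [r ->] <-]; rewrite setTI.
apply: is_interval_measurable => a b /=.
rewrite !in_itv/= => har hbr c /andP[]; rewrite le_eqVlt => /predU1P[<- //|ac].
rewrite le_eqVlt => /predU1P[-> //|cb].
have ab0 : b - a != 0 by lra.
have ba0 : 0 < b - a by lra.
pose t := (b - c) / (b - a).
have t01 : 0 < t < 1.
  by apply/andP; split; rewrite /t ?divr_gt0 ?ltr_pdivrMr//; lra.
have cE : c = t * a + (1 - t) * b by rewrite /t; field.
have t0 : 0 < t by case/andP: t01.
have t1 : 0 < 1 - t by case/andP: t01; lra.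
have ab : a != b by rewrite lt_eqF//; lra.
rewrite in_itv/= cE; apply: lt_trans (hc _ _ _ ab t01) _.
have := ltr_pM2l t0 (h a) r; have := ltr_pM2l t1 (h b) r.
rewrite har hbr; lra.
Qed.

(** The slope is the supremum of the left difference quotients at [a], which every right difference
    quotient bounds from above by convexity. *)
Lemma strictly_convex_subgradient (R : realType) (h : R -> R) (a : R) :
  strictly_convex h ->
  exists s, forall x, x != a -> h a + s * (x - a) < h x.
Proof.
move=> hc.
pose S := [set (h a - h (a - t)) / t | t in [set t | 0 < t]].
have Sub u : 0 < u -> ubound S ((h (a + u) - h a) / u).
  move=> u0 _ [t /= t0 <-]; rewrite ler_pdivrMr// mulrAC ler_pdivlMr//.
  have tu0 : 0 < t + u by lra.
  have := @strictly_convex_convex _ h (a + u) (a - t) (t / (t + u)) hc.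
  have -> : t / (t + u) * (a + u) + (1 - t / (t + u)) * (a - t) = a.
    by field; rewrite gt_eqF.
  have -> : 0 <= t / (t + u) <= 1.
    by rewrite ler_pdivrMr// ler_pdivlMr// mul0r mul1r; lra.
  move=> /(_ isT); rewrite -(ler_pM2l tu0).
  have -> (A B : R) : (t + u) * (t / (t + u) * A + (1 - t / (t + u)) * B) =
      t * A + u * B by field; rewrite gt_eqF.
  lra.
have hS : has_sup S.
  split; first by exists ((h a - h (a - 1)) / 1); exists 1 => //=; exact: ltr01.
  by exists ((h (a + 1) - h a) / 1); exact: Sub.
exists (sup S) => x xa.
have weak y : h a + sup S * (y - a) <= h y.
  have [ya|ya|->] := ltgtP y a; last by rewrite subrr mulr0 addr0.
    have ay : 0 < a - y by lra.
    have : (h a - h (a - (a - y))) / (a - y) <= sup S.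
      by apply: ub_le_sup; [exact: hS.2|exists (a - y)].
    rewrite ler_pdivrMr// subKr; lra.
  have ay : 0 < y - a by lra.
  have : sup S <= (h (a + (y - a)) - h a) / (y - a).
    by apply: ge_sup; [exact: hS.1|exact: Sub].
  rewrite ler_pdivlMr// subrKC; lra.
(* Strictness comes from the midpoint of [x] and [a]: the weak bound holds there, and strict
   convexity puts [h] strictly below the chord. *)
have := hc x a 2^-1 xa; rewrite invr_gt0 invf_lt1// ltr1n ltr0n => /(_ isT).
have := weak (2^-1 * x + (1 - 2^-1) * a); lra.
Qed.

(** For [u < 0], the point [u] is the mean of [v] and [0] with weight [t = u / v] on [v]. Strict
    convexity bounds [h u] by [h v] and [h 0], the supporting line at [0] eliminates [h 0], and
    dividing by [t] leaves the claim. *)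
Lemma strictly_convex_slope_lt (R : realType) (h : R -> R) (s u v : R) :
  strictly_convex h -> (forall x, x != 0 -> h 0 + s * x < h x) ->
  u <= 0 -> v < u -> h u + s * (v - u) < h v.
Proof.
move=> hc hs; rewrite le_eqVlt => /predU1P[-> v0|u0 vu].
  by rewrite subr0; apply: hs; rewrite lt_eqF.
have v0 : v < 0 by lra.
have t01 : 0 < u / v < 1.
  by rewrite ltr_ndivrMr// ltr_ndivlMr// mul0r mul1r u0 vu.
have := hc v 0 (u / v); rewrite lt_eqF// t01 mulr0 addr0 divfK ?lt_eqF//.
move=> /(_ isT isT); have := hs u; rewrite lt_eqF// => /(_ isT).
move: t01 => /andP[]; have : u = u / v * v by rewrite divfK ?lt_eqF.
move: (u / v) => t uE t0 t1 h1 h2.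
rewrite -(ltr_pM2l t0).
have : (1 - t) * (h 0 + s * u) < (1 - t) * h u by rewrite ltr_pM2l//; lra.
have -> : t * (h u + s * (v - u)) = t * h u + s * (t * v) - t * s * u by ring.
rewrite -uE; lra.
Qed.

(* Kantorovich potentials: [y |-> - s * (y - kappa)] on the target, and
   [x |-> h (x - max(kappa, x)) + s * (max(kappa, x) - kappa)] on the source. *)
Lemma threshold_cost_lt (R : realType) (h : R -> R) (s kappa x y : R) :
  strictly_convex h -> (forall u, u != 0 -> h 0 + s * u < h u) ->
  kappa <= y -> y != Num.max kappa x ->
  h (x - Num.max kappa x) + s * Num.max kappa x < h (x - y) + s * y.
Proof.
move=> hc hs ky; have [kx|xk] := ltP kappa x.
  move=> yx; have := hs (x - y).
  by rewrite subr_eq0 eq_sym yx => /(_ isT); rewrite subrr; lra.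
move=> yk; have {}ky : kappa < y by rewrite lt_neqAle eq_sym yk.
have := @strictly_convex_slope_lt _ h s (x - kappa) (x - y) hc hs.
have -> : x - y - (x - kappa) = kappa - y by ring.
rewrite subr_le0 xk ltrD2l ltrN2 ky => /(_ isT isT); lra.
Qed.

(** * Comparison of integrals of nonnegative functions, possibly infinite *)

Section nonnegative_integrals.
Local Open Scope ereal_scope.
Context d (T : measurableType d) (R : realType).
Variable m : {measure set T -> \bar R}.

Lemma ae_eq_of_le_ge0_integral (f g : T -> R) :
  measurable_fun [set: T] f -> measurable_fun [set: T] g ->
  (forall x, (0 <= f x)%R) -> (forall x, (0 <= g x)%R) ->
  {ae m, forall x, (f x <= g x)%R} ->
  \int[m]_x (g x)%:E <= \int[m]_x (f x)%:E -> \int[m]_x (f x)%:E < +oo ->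
  {ae m, forall x, f x = g x}.
Proof.
move=> mf mg f0 g0 fg gf foo.
(* Since [f <= g] holds only almost everywhere, the difference is truncated at 0 to be nonnegative
   everywhere. Then the integrals of [f] and [D] add up to at most that of [g], hence of [f], and
   the finite integral of [f] cancels. *)
pose D x := Num.max (g x - f x)%R 0%R.
have mD : measurable_fun [set: T] D.
  by apply: measurable_maxr => //; exact: measurable_funB.
have D0 x : (0 <= D x)%R by rewrite /D le_max lexx orbT.
have iD0 : \int[m]_x (D x)%:E = 0.
  have fin : \int[m]_x (f x)%:E \is a fin_num.
    by rewrite ge0_fin_numE// integral_ge0// => x _; rewrite lee_fin.
  apply/eqP; rewrite eq_le integral_ge0 ?andbT; last first.
    by move=> x _; rewrite lee_fin.
  rewrite -(leeD2lE _ _ fin) adde0 -ge0_integralD//; last 4 first.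
  - by move=> x _; rewrite lee_fin.
  - exact/measurable_EFinP.
  - by move=> x _; rewrite lee_fin.
  - exact/measurable_EFinP.
  apply: le_trans gf; apply: ae_ge0_le_integral => //.
  - by move=> x _; rewrite -EFinD lee_fin addr_ge0.
  - by apply/measurable_EFinP; exact: measurable_funD.
  - by move=> x _; rewrite lee_fin.
  - exact/measurable_EFinP.
  apply: filterS fg => x fgx _; rewrite -EFinD lee_fin /D max_l ?subr_ge0//.
  by rewrite subrKC.
have /ae_eq_integral_abs : measurable_fun [set: T] (EFin \o D).
  exact/measurable_EFinP.
move=> /(_ m measurableT)[+ _].
under eq_integral do rewrite gee0_abs ?lee_fin//.
move=> /(_ iD0); apply: filterS2 fg => x fgx /(_ I)[].
by rewrite /D max_l ?subr_ge0// => /eqP; rewrite subr_eq0 => /eqP.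
Qed.

(** Here [f1] and [f2] stand for the two costs, [a] and [b] for the potential terms. The latter have
    the same finite integral, so it cancels even when a cost is infinite. *)
Lemma le_integral_of_balanced (f1 f2 a b : T -> R) :
  measurable_fun [set: T] f1 -> measurable_fun [set: T] f2 ->
  measurable_fun [set: T] a -> measurable_fun [set: T] b ->
  (forall x, (0 <= f1 x)%R) -> (forall x, (0 <= f2 x)%R) ->
  (forall x, (0 <= a x)%R) -> (forall x, (0 <= b x)%R) ->
  \int[m]_x (a x)%:E = \int[m]_x (b x)%:E -> \int[m]_x (a x)%:E < +oo ->
  {ae m, forall x, (f1 x + a x <= f2 x + b x)%R} ->
  \int[m]_x (f1 x)%:E <= \int[m]_x (f2 x)%:E /\
  (\int[m]_x (f1 x)%:E < +oo -> \int[m]_x (f2 x)%:E <= \int[m]_x (f1 x)%:E ->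
   {ae m, forall x, (f1 x + a x = f2 x + b x)%R}).
Proof.
move=> mf1 mf2 ma mb f10 f20 a0 b0 iab aoo le12.
have fina : \int[m]_x (a x)%:E \is a fin_num.
  by rewrite ge0_fin_numE// integral_ge0// => x _; rewrite lee_fin.
have intD (f c : T -> R) : measurable_fun [set: T] f ->
    measurable_fun [set: T] c -> (forall x, (0 <= f x)%R) ->
    (forall x, (0 <= c x)%R) -> \int[m]_x (f x + c x)%:E =
    \int[m]_x (f x)%:E + \int[m]_x (c x)%:E.
  move=> mf mc f0 c0; rewrite -ge0_integralD//.
  - by move=> x _; rewrite lee_fin.
  - exact/measurable_EFinP.
  - by move=> x _; rewrite lee_fin.
  - exact/measurable_EFinP.
have mD1 : measurable_fun [set: T] (f1 \+ a)%R by exact: measurable_funD.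
have mD2 : measurable_fun [set: T] (f2 \+ b)%R by exact: measurable_funD.
have D10 x : (0 <= (f1 \+ a) x)%R by rewrite addr_ge0.
have D20 x : (0 <= (f2 \+ b) x)%R by rewrite addr_ge0.
split.
  rewrite -(leeD2rE _ _ fina) [in leRHS]iab -!intD//.
  apply: ae_ge0_le_integral => //.
  - by move=> x _; rewrite lee_fin; exact: D10.
  - exact/measurable_EFinP.
  - by move=> x _; rewrite lee_fin; exact: D20.
  - exact/measurable_EFinP.
  - by apply: filterS le12 => x; rewrite lee_fin.
move=> f1oo le21;
  apply: (@ae_eq_of_le_ge0_integral (f1 \+ a)%R (f2 \+ b)%R) => //.
  by rewrite !intD// -iab leeD2r.
by rewrite intD// lte_add_pinfty.
Qed.

End nonnegative_integrals.

(** * Optimality and uniqueness of the threshold map for a general source law *)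

Lemma transport_map_integral (R : realType) (m1 m2 : probability R R)
    (T : R -> R) (g : R -> R) :
  transport_map m1 m2 T -> measurable_fun [set: R] g -> (forall y, 0 <= g y) ->
  (\int[m1]_x (g (T x))%:E = \int[m2]_y (g y)%:E)%E.
Proof.
move=> [mT TE] mg g0.
have := @ge0_integral_pushforward _ _ _ _ R _ mT m1 setT (EFin \o g)
  measurableT.
rewrite preimage_setT => <-; first last.
- by move=> y _ /=; rewrite lee_fin.
- exact/measurable_EFinP.
by apply: eq_measure_integral => A mA _; exact: TE.
Qed.

Lemma threshold_optimal_transport (R : realType) (m1 m2 : probability R R)
    (h : R -> R) (kappa : R) :
  let Tstar := fun x : R => Num.max kappa x in
  let c := fun x y : R => h (x - y) in
  transport_map m1 m2 Tstar ->
  (\int[m2]_y (Num.max (y - kappa) 0)%:E < +oo)%E ->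
  (forall x, 0 <= h x) -> strictly_convex h ->
  optimal_transport_map m1 m2 c Tstar /\
  ((transport_cost m1 c Tstar < +oo)%E ->
    forall T, optimal_transport_map m1 m2 c T ->
      {ae m1, forall x, T x = Tstar x}).
Proof.
move=> Tstar c tTs finm2 h0 hc.
have mh := strictly_convex_measurable hc.
have [s hs'] := strictly_convex_subgradient 0 hc.
have {hs'} hs u : u != 0 -> h 0 + s * u < h u.
  by move=> u0; have := hs' u u0; rewrite subr0.
(* The excess over [kappa] equals [y - kappa] where the target has its mass, and it is nonnegative
   everywhere. *)
pose e (y : R) := Num.max (y - kappa) 0.
have me : measurable_fun [set: R] e.
  by apply: measurable_maxr => //; exact: measurable_funB.
have e0 y : 0 <= e y by rewrite le_max lexx orbT.
pose sp := Num.max s 0; pose sn := Num.max (- s) 0.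
have sp0 : 0 <= sp by rewrite le_max lexx orbT.
have sn0 : 0 <= sn by rewrite le_max lexx orbT.
have spn : s = sp - sn.
  by rewrite /sp /sn; have [] := ltP s 0; have [] := ltP (- s) 0; lra.
have mTs := tTs.1.
(* The target is the image of the source under [Num.max kappa], so it gives no mass to []-oo,
   kappa[]. *)
have ineq T : transport_map m1 m2 T -> {ae m1, forall x, kappa <= T x}.
  move=> [mT TE]; exists (T @^-1` `]-oo, kappa[%classic); split.
  - by rewrite -[X in measurable X]setTI; exact: mT.
  - have /= := TE `]-oo, kappa[%classic (measurable_itv _).
    rewrite /pushforward => ->; rewrite -tTs.2// /pushforward.
    rewrite (_ : _ @^-1` _ = set0) ?measure0//.
    apply/seteqP; split => x //=; rewrite in_itv/= /Tstar.
    by rewrite gt_max ltxx.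
  - by move=> x /= /negP; rewrite in_itv/= -ltNge.
have main T : transport_map m1 m2 T ->
    (transport_cost m1 c Tstar <= transport_cost m1 c T)%E /\
    ((transport_cost m1 c Tstar < +oo)%E ->
     (transport_cost m1 c T <= transport_cost m1 c Tstar)%E ->
     {ae m1, forall x, T x = Tstar x}).
  move=> tT; have mT := tT.1.
  have mcost (U : R -> R) : measurable_fun [set: R] U ->
      measurable_fun [set: R] (fun x => h (x - U x)).
    by move=> mU; apply: measurableT_comp => //; exact: measurable_funB.
  have meT := measurableT_comp me mT.
  have meTs := measurableT_comp me mTs.
  (* [s] may have either sign: splitting it keeps all integrands nonnegative. *)
  pose a x := sp * e (Tstar x) + sn * e (T x).
  pose b x := sp * e (T x) + sn * e (Tstar x).
  have ma : measurable_fun [set: R] a.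
    by apply: measurable_funD; apply: measurable_funM.
  have mb : measurable_fun [set: R] b.
    by apply: measurable_funD; apply: measurable_funM.
  (* The value does not depend on [U] and [V], so exchanging [Tstar] and [T] shows that [a] and [b]
     have equal integrals. *)
  have intE (U V : R -> R) : transport_map m1 m2 U -> transport_map m1 m2 V ->
      (\int[m1]_x (sp * e (U x) + sn * e (V x))%:E =
       sp%:E * \int[m2]_y (e y)%:E + sn%:E * \int[m2]_y (e y)%:E)%E.
    move=> tU tV; under eq_integral do rewrite EFinD !EFinM.
    have meU := measurableT_comp me tU.1.
    have meV := measurableT_comp me tV.1.
    rewrite ge0_integralD//; last 4 first.
    - by move=> x _; rewrite -EFinM lee_fin mulr_ge0.
    - by apply/measurable_EFinP; exact: measurable_funM.
    - by move=> x _; rewrite -EFinM lee_fin mulr_ge0.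
    - by apply/measurable_EFinP; exact: measurable_funM.
    rewrite !ge0_integralZl_EFin//; try (by move=> x _; rewrite lee_fin);
      try exact/measurable_EFinP.
    by rewrite (transport_map_integral tU)// (transport_map_integral tV).
  have ab : ({ae m1, forall x, h (x - Tstar x) + a x <= h (x - T x) + b x} /\
    ({ae m1, forall x, h (x - Tstar x) + a x = h (x - T x) + b x} ->
     {ae m1, forall x, T x = Tstar x})).
    have lt_ab x : kappa <= T x -> T x != Tstar x ->
        h (x - Tstar x) + a x < h (x - T x) + b x.
      (* Both values are at least [kappa], so the truncations disappear and
         [a x - b x = s * (Tstar x - T x)]. *)
      move=> kT TTs; have := threshold_cost_lt hc hs kT TTs.
      rewrite -/(Tstar x) /a /b /e !max_l ?subr_ge0// ?le_max ?lexx//.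
      rewrite spn; lra.
    split.
      apply: filterS (ineq _ tT) => x kT.
      have [TTs|/(lt_ab _ kT)/ltW//] := eqVneq (T x) (Tstar x).
      by rewrite /a /b TTs.
    apply: filterS2 (ineq _ tT) => x kT E.
    by apply/eqP; apply: contraT => /(lt_ab _ kT); rewrite E ltxx.
  have [] := @le_integral_of_balanced _ _ _ m1 (fun x => h (x - Tstar x))
    (fun x => h (x - T x)) a b.
  - exact: mcost.
  - exact: mcost.
  - exact: ma.
  - exact: mb.
  - by move=> x; exact: h0.
  - by move=> x; exact: h0.
  - by move=> x; rewrite addr_ge0// mulr_ge0.
  - by move=> x; rewrite addr_ge0// mulr_ge0.
  - by rewrite !intE.
  - by rewrite intE// lte_add_pinfty// lte_mul_pinfty// lee_fin.
  - exact: ab.1.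
  move=> le1 le2; split => // fin le; apply: ab.2; exact: le2.
split; first by split => // T /main[].
move=> fin T [tT opt]; apply: (main T tT).2 => //; exact: opt.
Qed.

(** * The SVM margins: labels, finite first moment, conclusion *)

Lemma ae_label (d : measure_display) (Omega : measurableType d)
    (R : realType) (P : probability Omega R) (prior : R) (Y G : {RV P >-> R}) :
  label_noise_pair prior Y G -> {ae P, forall w, (Y w == 1) || (Y w == -1)}.
Proof.
move=> [Y1 YN1 _ _].
have m1 (r : R) : measurable [set w | Y w = r].
  by rewrite -[X in measurable X]setTI;
    exact: (measurable_funPT Y measurableT _ (measurable_set1 r)).
have PU : P ([set w | Y w = 1] `|` [set w | Y w = -1]) = 1%:E.
  rewrite measureU//.
    by rewrite [X in (X + _)%E]Y1 [X in (_ + X)%E]YN1 -EFinD subrKC.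
  (* The two events are disjoint, as a common point would give [1 + 1 = 0]. *)
  by apply/seteqP; split => w //= [-> /eqP];
    rewrite -addr_eq0 gt_eqF// addr_gt0.
exists (~` ([set w | Y w = 1] `|` [set w | Y w = -1])); split.
- by apply: measurableC; exact: measurableU.
- by rewrite probability_setC ?PU ?subee//; exact: measurableU.
- by move=> w /=; apply: contra_not => -[] ->; rewrite eqxx ?orbT.
Qed.

(* A feasible point has [svm_H > 0]; since [fine +oo = 0] and division by [0]
   is [0], this forces the squared hinge loss to have finite expectation. *)
Lemma train_margin_excess_finite (d : measure_display)
    (Omega : measurableType d) (R : realType) (P : probability Omega R)
    (Y G : {RV P >-> R}) (prior : R) (p : nat) (mu : 'rV[R]_p)
    (tau delta rho beta0 kappa : R) :
  label_noise_pair prior Y G -> 0 < delta ->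
  svm_feasible Y G mu tau delta rho beta0 kappa ->
  (\int[distribution P (train_margin Y G mu rho beta0 kappa)]_y
     (Num.max (y - kappa) 0)%:E < +oo)%E.
Proof.
move=> /ae_label Ypm d0 [_ /(lt_le_trans d0)]; rewrite /svm_H unlock.
set m := rho * l2norm mu.
pose Z w := Num.max (margin_scale tau (Y w) * kappa - m + G w - beta0 * Y w) 0.
have Z0 w : 0 <= Z w ^+ 2 by rewrite sqr_ge0.
have mscale : measurable_fun [set: Omega] (fun w => margin_scale tau (Y w)).
  apply: measurable_fun_ifT => //=.
  exact: measurable_fun_eqr.
have mZ : measurable_fun [set: Omega] Z.
  apply: measurable_maxr => //.
  apply: measurable_funB; last exact: measurable_funM.
  apply: measurable_funD => //.
  by apply: measurable_funB => //; exact: measurable_funM.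
have Zoo H : 0 < (1 - rho ^+ 2) / fine H -> (0 <= H)%E -> (H < +oo)%E.
  by case: H => [r _ _||] /=; rewrite ?ltry ?invr0 ?mulr0 ?ltxx.
move=> /Zoo; have iZ0 : (0 <= \int[P]_w (Z w ^+ 2)%:E)%E.
  by apply: integral_ge0 => w _; rewrite lee_fin.
move=> /(_ iZ0) iZoo.
have mexc : measurable_fun [set: R] (fun y => Num.max (y - kappa) 0).
  by apply: measurable_maxr => //; exact: measurable_funB.
rewrite ge0_integral_distribution; last 2 first.
- exact/measurable_EFinP.
- by move=> y; rewrite lee_fin le_max lexx orbT.
(* The margin carries [m] and [Y * beta0] with signs opposite to those in the hinge loss, hence the
   factors 2. The [kappa] terms cover both label scales, and the 1 pays for
   [Z w <= Z w ^+ 2 + 1]. *)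
pose C := 1 + `|2 * m| + 2 * `|beta0| + 2 * `|kappa| + `|tau * kappa|.
have C0 : 0 <= C by rewrite /C !addr_ge0 ?mulr_ge0.
have CZoo : (\int[P]_w (C + Z w ^+ 2)%:E < +oo)%E.
  under eq_integral do rewrite EFinD.
  rewrite ge0_integralD//.
  - rewrite integral_cst// [X in (_ * X)%E](_ : _ = 1%E).
      by rewrite mule1 lte_add_pinfty// ltry.
    exact: probability_setT.
  - by move=> w _; rewrite lee_fin.
  - by apply/measurable_EFinP; exact: measurable_funX.
apply: le_lt_trans CZoo; apply: ae_ge0_le_integral => //.
- by move=> w _; rewrite lee_fin le_max lexx orbT.
- apply/measurable_EFinP.
  exact: measurableT_comp mexc (measurable_train_margin Y G mu rho beta0 kappa).
- by move=> w _; rewrite lee_fin addr_ge0.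
- apply/measurable_EFinP.
  by apply: measurable_funD => //; exact: measurable_funX.
apply: filterS Ypm => w Yw _; rewrite /= lee_fin /train_margin -/m.
have ZC : m + G w + Y w * beta0 - kappa <= Z w + (C - 1).
  apply: le_trans (_ : margin_scale tau (Y w) * kappa - m + G w - beta0 * Y w
     + (C - 1) <= _); last by rewrite lerD2r le_max lexx.
  have := ler_norm (2 * m); have := ler_norm beta0; have := ler_norm (- beta0).
  have := ler_norm (- kappa); have := ler_norm (- (tau * kappa)).
  have := normr_ge0 kappa; have := normr_ge0 (tau * kappa).
  rewrite !normrN /C /margin_scale.
  by case/orP: Yw => /eqP ->; case: ifP => _; lra.
have Z1 : Z w <= Z w ^+ 2 + 1 by have := sqr_ge0 (Z w - 1); nra.
rewrite ge_max addr_ge0// andbT lerBlDr ge_max; apply/andP; split; last lra.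
by have := Z0 w; lra.
Qed.

Theorem proposition4p2 (R : realType)
    (d : measure_display) (Omega : measurableType d) (P : probability Omega R)
    (Y G : {RV P >-> R}) (prior : R) (p : nat) (mu : 'rV[R]_p)
    (tau delta dstar0 rho beta0 kappa : R) (h : R -> R)
    (hprior : 0 < prior < 2^-1)
    (hYG : label_noise_pair prior Y G)
    (hmu : 0 < l2norm mu)
    (htau : 0 < tau)
    (hdstar0 : is_delta_star Y G mu tau 0 dstar0)
    (hdelta : 0 < delta < dstar0)
    (hsol : svm_solution Y G mu tau delta rho beta0 kappa)
    (h_ge0 : forall x, 0 <= h x)
    (h_conv : strictly_convex h) :
  let Ltest : probability R R := distribution P (test_margin Y G mu rho beta0) in
  let Ltrain : probability R R :=
    distribution P (train_margin Y G mu rho beta0 kappa) in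
  let c := fun x y : R => h (x - y) in
  let Tstar := fun x : R => Num.max kappa x in
  optimal_transport_map Ltest Ltrain c Tstar /\
  ((transport_cost Ltest c Tstar < +oo)%E ->
    forall T : R -> R, optimal_transport_map Ltest Ltrain c T ->
      {ae Ltest, forall x, T x = Tstar x}).
Proof.
have d0 : 0 < delta by case/andP: hdelta.
apply: threshold_optimal_transport => //; last first.
  exact: train_margin_excess_finite hYG d0 hsol.1.
(* [train_margin] is by definition [Tstar] composed with [test_margin], so the push-forward identity
   holds by computation. *)
by split => //; exact: measurable_maxr.
Qed.
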